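(* Let $X$ be a riemannian manifold. If $\phi$ is a closed differential $p$-form on $X$, then for every $f\in C^\infty(X)$ $$\mathcal H^\phi(f)\ =\ dd^\phi f-\nabla_{\nabla f}\phi .$$
   Context: $\nabla$ denotes the Levi-Civita connection and $\nabla f$ the gradient of $f$; $\nabla_{\nabla f}\phi$ is the covariant derivative of $\phi$ in the direction $\nabla f$. The operator $d^\phi$ from functions to $(p-1)$-forms is $d^\phi f=\nabla f\,\lrcorner\,\phi$ (interior product of the gradient with $\phi$), and $dd^\phi f=d(d^\phi f)$ is its exterior derivative. The $\phi$-Hessian of $f$ is the $p$-form obtained by letting the symmetric endomorphism $\mathrm{Hess} f: V\mapsto\nabla_V(\nabla f)$ act on $\phi$ as a derivation: $$\mathcal H^\phi(f)(v_1,\dots,v_p)=\sum_{i=1}^p\phi(v_1,\dots,\nabla_{v_i}(\nabla f),\dots,v_p),$$ with $\nabla_{v_i}(\nabla f)$ in the $i$-th slot. *)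

(* Defs.v *)
From HB Require Import structures.
From mathcomp Require Import all_boot all_order all_algebra.
From mathcomp Require Import all_classical all_reals all_analysis.
Set Implicit Arguments.
Unset Strict Implicit.
Unset Printing Implicit Defensive.
Import Order.TTheory GRing.Theory Num.Theory numFieldNormedType.Exports.
Local Open Scope classical_set_scope.
Local Open Scope ring_scope.

(* F is of class C^k on the open set U: for k + 1, F is (Frechet)
   differentiable on U and every directional derivative is C^k on U. *)
Fixpoint class_C (R : realType) (V W : normedModType R) (k : nat) (U : set V)
    (F : V -> W) : Prop :=
  match k with
  | 0 => forall u, U u -> {for u, continuous F}
  | k'.+1 => (forall u, U u -> differentiable F u) /\
             (forall v, class_C k' U (fun u => 'D_v F u))
  end.

Definition smooth_on (R : realType) (V W : normedModType R) (U : set V)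
    (F : V -> W) : Prop :=
  forall k, class_C k U F.

Definition smooth_near (R : realType) (V W : normedModType R) (u : V)
    (F : V -> W) : Prop :=
  exists U : set V, [/\ open U, U u & smooth_on U F].

(* A chart is a homeomorphism from an open set of T onto an open set of R^n;
   the values of the two maps outside these sets are irrelevant. *)
Record chart (R : realType) (n : nat) (T : topologicalType) := Chart {
  chart_dom : set T;
  chart_img : set 'rV[R]_n;
  chart_to :> T -> 'rV[R]_n;
  chart_inv : 'rV[R]_n -> T;
  chart_dom_open : open chart_dom;
  chart_img_open : open chart_img;
  chart_to_img : forall x, chart_dom x -> chart_img (chart_to x);
  chart_inv_dom : forall u, chart_img u -> chart_dom (chart_inv u);
  chart_toK : forall x, chart_dom x -> chart_inv (chart_to x) = x;
  chart_invK : forall u, chart_img u -> chart_to (chart_inv u) = u;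
  chart_to_cont : forall x, chart_dom x -> {for x, continuous chart_to};
  chart_inv_cont : forall u, chart_img u -> {for u, continuous chart_inv}
}.

Record smooth_manifold (R : realType) (n : nat) := SmoothManifold {
  carrier :> topologicalType;
  manifold_hausdorff : hausdorff_space carrier;
  manifold_second_countable : @second_countable carrier;
  atlas : set (chart R n carrier);
  atlas_cover : forall x, exists c, atlas c /\ chart_dom c x;
  atlas_compat : forall c c', atlas c -> atlas c' ->
    smooth_on (chart_img c `&` chart_inv c @^-1` chart_dom c')
              (c' \o chart_inv c)
}.

(* A chosen chart of the atlas around x. *)
Definition chart_at (R : realType) (n : nat) (X : smooth_manifold R n) (x : X) :
    chart R n X :=
  projT1 (cid (atlas_cover x)).

(* T_x X: a tangent vector at x is represented by its coordinates in the chosen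
   chart at x.  The two maps chart_diff and chart_frame below pass to and from
   its coordinates in any other chart around x. *)
Definition tangent (R : realType) (n : nat) (X : smooth_manifold R n) (x : X) :
    normedModType R :=
  'rV[R]_n.

(* The differential at y of the chart c, and of its inverse at c y. *)
Definition chart_diff (R : realType) (n : nat) (X : smooth_manifold R n)
    (c : chart R n X) (y : X) (w : tangent y) : 'rV[R]_n :=
  'd (c \o chart_inv (chart_at y)) (chart_at y y) w.

Definition chart_frame (R : realType) (n : nat) (X : smooth_manifold R n)
    (c : chart R n X) (y : X) (e : 'rV[R]_n) : tangent y :=
  'd (chart_at y \o chart_inv c) (c y) e.

Definition vector_field (R : realType) (n : nat) (X : smooth_manifold R n) :=
  forall x : X, tangent x.

(* Possibly non-alternating and non-smooth families of functions of p tangent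
   vectors; see differential_form. *)
Definition preform (R : realType) (n : nat) (X : smooth_manifold R n) (p : nat) :=
  forall x : X, ('I_p -> tangent x) -> R.

(* Local expressions in the chart c of functions, vector fields, p-forms and
   covariant 2-tensors. *)
Definition fun_rep (R : realType) (n : nat) (X : smooth_manifold R n)
    (c : chart R n X) (f : X -> R) (u : 'rV[R]_n) : R :=
  f (chart_inv c u).

Definition field_rep (R : realType) (n : nat) (X : smooth_manifold R n)
    (c : chart R n X) (W : vector_field X) (u : 'rV[R]_n) : 'rV[R]_n :=
  chart_diff c (W (chart_inv c u)).

Definition form_rep (R : realType) (n : nat) (X : smooth_manifold R n) (p : nat)
    (c : chart R n X) (phi : preform X p) (u : 'rV[R]_n)
    (e : 'I_p -> 'rV[R]_n) : R :=
  phi (chart_inv c u) (fun i => chart_frame c (chart_inv c u) (e i)).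

Definition metric_rep (R : realType) (n : nat) (X : smooth_manifold R n)
    (c : chart R n X) (g : forall x : X, tangent x -> tangent x -> R)
    (u : 'rV[R]_n) (e e' : 'rV[R]_n) : R :=
  g (chart_inv c u) (chart_frame c (chart_inv c u) e)
                    (chart_frame c (chart_inv c u) e').

(* Smoothness on a neighbourhood of x, read in the chosen chart at x; by
   atlas_compat this does not depend on the chart. *)
Definition smooth_fun_near (R : realType) (n : nat) (X : smooth_manifold R n)
    (x : X) (f : X -> R) : Prop :=
  smooth_near (chart_at x x) (fun_rep (chart_at x) f).

Definition smooth_field_near (R : realType) (n : nat) (X : smooth_manifold R n)
    (x : X) (W : vector_field X) : Prop :=
  smooth_near (chart_at x x) (field_rep (chart_at x) W).

Definition smooth_fun (R : realType) (n : nat) (X : smooth_manifold R n)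
    (f : X -> R) : Prop :=
  forall x : X, smooth_fun_near x f.

Definition differential_form (R : realType) (n : nat) (X : smooth_manifold R n)
    (p : nat) (phi : preform X p) : Prop :=
  [/\ forall (x : X) (v : 'I_p -> tangent x) (i : 'I_p) (a : R) (w w' : tangent x),
        phi x (dfwith v i (a *: w + w')) =
          a * phi x (dfwith v i w) + phi x (dfwith v i w'),
      forall (x : X) (v : 'I_p -> tangent x) (i j : 'I_p),
        i != j -> v i = v j -> phi x v = 0
    & forall (x : X) (e : 'I_p -> 'rV[R]_n),
        smooth_near (chart_at x x) (fun u => form_rep (chart_at x) phi u e)].

Definition riemannian_metric (R : realType) (n : nat) (X : smooth_manifold R n)
    (g : forall x : X, tangent x -> tangent x -> R) : Prop :=
  [/\ forall (x : X) (a : R) (v v' w : tangent x),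
        g x (a *: v + v') w = a * g x v w + g x v' w,
      forall (x : X) (v w : tangent x), g x v w = g x w v,
      forall (x : X) (v : tangent x), v != 0 -> 0 < g x v v
    & forall (x : X) (e e' : 'rV[R]_n),
        smooth_near (chart_at x x) (fun u => metric_rep (chart_at x) g u e e')].

Definition dir_deriv (R : realType) (n : nat) (X : smooth_manifold R n)
    (x : X) (v : tangent x) (f : X -> R) : R :=
  'D_v (fun_rep (chart_at x) f) (chart_at x x).

Definition lie_bracket (R : realType) (n : nat) (X : smooth_manifold R n)
    (V W : vector_field X) (x : X) : tangent x :=
  'D_(V x) (field_rep (chart_at x) W) (chart_at x x) -
  'D_(W x) (field_rep (chart_at x) V) (chart_at x x).

(* D x v W is the covariant derivative at x of the vector field W in the
   direction v.  W need only be defined and smooth near x (a total function with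
   junk values elsewhere): a connection differentiates local sections. *)
Definition affine_connection (R : realType) (n : nat) (X : smooth_manifold R n)
    (D : forall x : X, tangent x -> vector_field X -> tangent x) : Prop :=
  [/\ forall (x : X) (W : vector_field X) (a : R) (v v' : tangent x),
        smooth_field_near x W ->
        D x (a *: v + v') W = a *: D x v W + D x v' W,
      forall (x : X) (v : tangent x) (W W' : vector_field X),
        smooth_field_near x W -> smooth_field_near x W' ->
        D x v (fun y => W y + W' y) = D x v W + D x v W',
      forall (x : X) (v : tangent x) (h : X -> R) (W : vector_field X),
        smooth_fun_near x h -> smooth_field_near x W ->
        D x v (fun y => h y *: W y) = dir_deriv v h *: W x + h x *: D x v W
    & forall (x : X) (V W : vector_field X),
        smooth_field_near x V -> smooth_field_near x W ->
        smooth_field_near x (fun y => D y (V y) W)].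

Definition levi_civita (R : realType) (n : nat) (X : smooth_manifold R n)
    (g : forall x : X, tangent x -> tangent x -> R)
    (D : forall x : X, tangent x -> vector_field X -> tangent x) : Prop :=
  [/\ affine_connection D,
      forall (x : X) (V W : vector_field X),
        smooth_field_near x V -> smooth_field_near x W ->
        D x (V x) W - D x (W x) V = lie_bracket V W x
    & forall (x : X) (v : tangent x) (W Z : vector_field X),
        smooth_field_near x W -> smooth_field_near x Z ->
        dir_deriv v (fun y => g y (W y) (Z y)) =
          g x (D x v W) (Z x) + g x (W x) (D x v Z)].

(* The vector field metrically dual to df. *)
Definition grad (R : realType) (n : nat) (X : smooth_manifold R n)
    (g : forall x : X, tangent x -> tangent x -> R) (f : X -> R) :
    vector_field X :=
  fun x => xget (0 : tangent x)
    [set w : tangent x | forall v : tangent x, g x w v = dir_deriv v f].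

(* The exterior derivative, computed at x in the chosen chart at x, normalized
   so that d(f dx_1 ... dx_p) = df /\ dx_1 ... dx_p with
   (dx_1 /\ ... /\ dx_p)(e_1, ..., e_p) = 1. *)
Definition ext_deriv (R : realType) (n : nat) (X : smooth_manifold R n) (p : nat)
    (phi : preform X p) : preform X p.+1 :=
  fun x v => \sum_(i < p.+1) (-1) ^+ i *
    'D_(v i) (fun u => form_rep (chart_at x) phi u (fun j => v (lift i j)))
             (chart_at x x).

Definition closed_form (R : realType) (n : nat) (X : smooth_manifold R n) (p : nat)
    (phi : preform X p) : Prop :=
  forall (x : X) (v : 'I_p.+1 -> tangent x), ext_deriv phi v = 0.

Definition interior_product (R : realType) (n : nat) (X : smooth_manifold R n)
    (p : nat) (W : vector_field X) (phi : preform X p.+1) : preform X p :=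
  fun x v => phi x (fun i => oapp v (W x) (unlift ord0 i)).

(* The local vector field near x with constant coordinates in the chosen chart
   at x and value v at x. *)
Definition coord_field (R : realType) (n : nat) (X : smooth_manifold R n)
    (x : X) (v : tangent x) : vector_field X :=
  fun y => chart_frame (chart_at x) y v.

(* nabla_w phi at x.  The usual formula
     w (phi (V_1, ..., V_p)) - \sum_i phi (V_1, ..., nabla_w V_i, ..., V_p)
   does not depend on the local extensions V_i of the v_i. *)
Definition cov_deriv_form (R : realType) (n : nat) (X : smooth_manifold R n)
    (D : forall x : X, tangent x -> vector_field X -> tangent x)
    (p : nat) (phi : preform X p) (x : X) (w : tangent x)
    (v : 'I_p -> tangent x) : R :=
  dir_deriv w (fun y => phi y (fun i => coord_field (v i) y)) -
  \sum_(i < p) phi x (dfwith v i (D x w (coord_field (v i)))).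

Definition phi_hessian (R : realType) (n : nat) (X : smooth_manifold R n)
    (g : forall x : X, tangent x -> tangent x -> R)
    (D : forall x : X, tangent x -> vector_field X -> tangent x)
    (p : nat) (phi : preform X p) (f : X -> R) : preform X p :=
  fun x v => \sum_(i < p) phi x (dfwith v i (D x (v i) (grad g f))).

Definition d_phi (R : realType) (n : nat) (X : smooth_manifold R n)
    (g : forall x : X, tangent x -> tangent x -> R)
    (p : nat) (phi : preform X p.+1) (f : X -> R) : preform X p :=
  interior_product (grad g f) phi.

(* Main.v *)
Require Import Defs.
From mathcomp Require Import all_boot all_order all_algebra all_fingroup.
From mathcomp Require Import all_classical all_reals all_analysis.
From mathcomp Require Import zify ring.
Import Order.TTheory GRing.Theory Num.Theory numFieldNormedType.Exports.
Set Implicit Arguments.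
Unset Strict Implicit.
Unset Printing Implicit Defensive.
Local Open Scope classical_set_scope.
Local Open Scope ring_scope.

(** Fix a point [x], let [c] be the chart chosen at [x], let [W = grad f], and
    extend the vectors [v_i] to the fields [V_i] with constant coordinates in
    [c].  In the chart the bracket [[V_i, W]] is the directional derivative
    [D_{v_i} W] of the coordinate expression of [W], since the [V_i] have
    constant coordinates.  As the connection is torsion-free,

      nabla_{v_i} W = nabla_{W x} V_i + D_{v_i} W

    ([levi_civita_coord_field]).  Substituted in the Hessian, the terms
    [nabla_{W x} V_i] are those subtracted in [nabla_W phi], so it remains to
    prove the flat identity

      d (W _| phi) (v) = D_{W x} (phi (v)) + \sum_i phi (.., D_{v_i} W, ..)

    which is Cartan's formula for a closed form, the right-hand side being the
    Lie derivative of [phi] along [W].  By the product rule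
    ([derive_interior]), each term of [d (W _| phi)] splits into a derivative
    of the coefficients of [phi] with [W] frozen at [x], and a term
    [phi (D_{v_i} W, v without v_i)].  Closedness of [phi], applied to the
    tuple [(W x, v_0, .., v_p)], identifies the alternating sum of the former
    with [D_{W x} (phi (v))] ([closed_form_slot0]); moving [D_{v_i} W] from the
    first slot to the [i]-th one absorbs the sign of the latter
    ([alternating_slot0]).

    Torsion-freeness and the product rule only apply to fields that are smooth
    near [x], so the smoothness of the gradient has to be established
    ([smooth_grad]).  Its coordinates in a chart are those of [df] multiplied
    by the inverse of the Gram matrix of the metric ([field_rep_grad]), and the
    inverse of a matrix with smooth entries is smooth ([smooth_near_invmx]). *)

(** * Smooth functions on normed modules *)

Section Smooth.
Variables (R : realType) (V : normedModType R).
Implicit Types (W : normedModType R) (u v : V) (U : set V) (k : nat).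

(** The differential is a germ invariant: [F] and [G] have the same increments
    near [u], hence the same first-order expansion. *)
Lemma near_eq_diff W (F G : V -> W) u :
  (\near u, F u = G u) -> differentiable F u ->
  differentiable G u /\ 'd G u = 'd F u :> (V -> W).
Proof.
move=> FG dF; have [cF eF] := (diff_locallyP _ _).1 dF.
have FGu : F u = G u by exact: nbhs_singleton FG.
have eG : G \o shift u = cst (G u) + 'd F u +o_ 0 id.
  apply/eqaddoP => e e0.
  have /eqaddoP /(_ e e0) := eF.
  have FG0 : \forall h \near (0 : V), F (h + u) = G (h + u).
    by move: FG; rewrite [X in X -> _](near_shift 0) subr0.
  move: FG0; apply: filterS2 => h hFG.
  by rewrite !fctE /= hFG FGu.
have dG : 'd G u = 'd F u :> (V -> W) by exact: diff_unique.
split; last exact: dG.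
by apply/diff_locallyP; split; rewrite dG; [exact: cF|exact: eG].
Qed.

Lemma class_CW k U W (F : V -> W) : class_C k.+1 U F -> class_C k U F.
Proof.
elim: k F => [|k IH] F [dF DF].
  by move=> u /dF /differentiable_continuous.
by split=> // v; apply: IH; exact: DF.
Qed.

Lemma class_C_sub k U U' W (F : V -> W) :
  U' `<=` U -> class_C k U F -> class_C k U' F.
Proof.
move=> UU'; elim: k F => [|k IH] F /=; first by move=> h u /UU' /h.
by move=> [dF DF]; split=> [u /UU' /dF//|v]; apply: IH; exact: DF.
Qed.

Lemma class_C_ext k U W (F G : V -> W) : open U ->
  {in U, F =1 G} -> class_C k U F -> class_C k U G.
Proof.
move=> oU; elim: k F G => [|k IH] F G FG /=.
  move=> cF u Uu; have FGu : \near u, F u = G u.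
    by apply: filterS (open_nbhs_nbhs (conj oU Uu)) => z Uz; apply/FG/mem_set.
  suff : G @ u --> F u by rewrite (nbhs_singleton FGu).
  by apply: cvg_trans (cF u Uu); exact: near_eq_cvg.
have FGu u : U u -> \near u, F u = G u.
  move=> Uu; apply: filterS (open_nbhs_nbhs (conj oU Uu)) => z Uz.
  exact/FG/mem_set.
move=> [dF DF]; split=> [u Uu|v].
  by have [] := near_eq_diff (FGu u Uu) (dF u Uu).
apply: IH (DF v) => u /set_mem Uu; exact: near_eq_derive (FGu u Uu).
Qed.

Lemma class_C_cst k U W (w : W) : class_C k U (fun=> w : W).
Proof.
elim: k w => [|k IH] w /=; first by move=> u _; exact: cvg_cst.
split=> [u _|v]; first exact: differentiable_cst.
suff -> : 'D_v (fun=> w) = (fun=> 0) :> (V -> W) by exact: IH.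
by apply/funext => u; exact: derive_cst.
Qed.

Lemma class_C_add k U W (F G : V -> W) : open U ->
  class_C k U F -> class_C k U G -> class_C k U (fun u => F u + G u).
Proof.
move=> oU; elim: k F G => [|k IH] F G /=.
  by move=> cF cG u Uu; apply: cvgD; [exact: cF|exact: cG].
move=> [dF DF] [dG DG]; split=> [u Uu|v].
  by apply: differentiableD; [exact: dF|exact: dG].
apply: (@class_C_ext _ _ _ (fun u => 'D_v F u + 'D_v G u)) => //.
  move=> u /set_mem Uu; rewrite deriveD //.
  - by apply: diff_derivable; exact: dF.
  - by apply: diff_derivable; exact: dG.
exact: IH.
Qed.

Lemma class_C_scale k U W (a : V -> R) (w : W) : open U ->
  class_C k U a -> class_C k U (fun u => a u *: w).
Proof.
move=> oU; elim: k a => [|k IH] a /=.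
  by move=> ca u Uu; apply: cvgZr_tmp; exact: ca.
move=> [da Da]; split=> [u Uu|v]; first by apply: differentiableZl; exact: da.
apply: (@class_C_ext _ _ _ (fun u => 'D_v a u *: w)) => //; last exact: IH.
move=> u /set_mem Uu.
have dau := da u Uu; rewrite [RHS]deriveE; last exact: differentiableZl.
by rewrite deriveE // diffZl.
Qed.

Lemma class_C_mul k U (a b : V -> R) : open U ->
  class_C k U a -> class_C k U b -> class_C k U (fun u => a u * b u).
Proof.
move=> oU; elim: k a b => [|k IH] a b.
  by move=> ca cb u Uu; apply: cvgM; [exact: ca|exact: cb].
move=> Ca Cb; have [da Da] := Ca; have [db Db] := Cb; split=> [u Uu|v].
  by apply: differentiableM; [exact: da|exact: db].
apply: (@class_C_ext _ _ _ (fun u => a u * 'D_v b u + b u * 'D_v a u)) => //.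
  move=> u /set_mem Uu; rewrite deriveM //.
  - by apply: diff_derivable; exact: da.
  - by apply: diff_derivable; exact: db.
apply: class_C_add => //; apply: IH.
- exact: class_CW.
- exact: Db.
- exact: class_CW.
- exact: Da.
Qed.

(** Induction on the order of smoothness: the derivative of [1 / a] is
    [- a' / a ^ 2], and [1 / a] is smooth to the lower order by induction. *)
Lemma class_C_inv k U (a : V -> R) : open U -> (forall u, U u -> a u != 0) ->
  class_C k U a -> class_C k U (fun u => (a u)^-1).
Proof.
move=> oU a0; elim: k => [|k IH].
  by move=> ca u Uu; apply: cvgV; [exact: a0|exact: ca].
move=> Ca; have [da Da] := Ca; split=> [u Uu|v].
  by apply: differentiableV; [exact: da|exact: a0].
apply: (@class_C_ext _ _ _ (fun u => (a u)^-1 * (a u)^-1 * (-1 * 'D_v a u)))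
  => //.
  move=> u /set_mem Uu; rewrite deriveV.
  - by rewrite mulN1r mulrN -invfM -expr2 -scaleNr /GRing.scale /= mulNr.

  - exact: a0.
  - by apply: diff_derivable; exact: da.
have Cv : class_C k U (fun u => (a u)^-1) by apply: IH; exact: class_CW.
by do 2?apply: class_C_mul => //; [exact: class_C_cst|exact: Da].
Qed.

Lemma smooth_near_differentiable u W (F : V -> W) :
  smooth_near u F -> differentiable F u.
Proof. by move=> [U [_ Uu /(_ 1%N) [dF _]]]; exact: dF. Qed.

Lemma smooth_near_derive u v W (F : V -> W) :
  smooth_near u F -> smooth_near u ('D_v F).
Proof.
move=> [U [oU Uu sF]]; exists U; split=> // k.
by have [_ DF] := sF k.+1; exact: DF.
Qed.

Lemma smooth_near_ext u W (F G : V -> W) :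
  (\near u, F u = G u) -> smooth_near u F -> smooth_near u G.
Proof.
move=> FG [U [oU Uu sF]]; pose U' := U `&` interior [set z | F z = G z].
have oU' : open U' by apply: openI => //; exact: open_interior.
exists U'; split=> // k; apply: (@class_C_ext _ _ _ F) => //.
  by move=> z /set_mem [_ /interior_subset].
by apply: class_C_sub (sF k) => z [].
Qed.

Lemma smooth_near_eq u W (F G : V -> W) :
  F =1 G -> smooth_near u F -> smooth_near u G.
Proof. by move=> /funext ->. Qed.

Lemma smooth_near_cst u W (w : W) : smooth_near u (fun=> w : W).
Proof. by exists setT; split=> [|//|k]; [exact: openT|exact: class_C_cst]. Qed.

Lemma smooth_near_add u W (F G : V -> W) :
  smooth_near u F -> smooth_near u G -> smooth_near u (fun z => F z + G z).
Proof.
move=> [U [oU Uu sF]] [U' [oU' Uu' sG]]; have oI := openI oU oU'.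
exists (U `&` U'); split=> // k; apply: class_C_add => //.
- by apply: class_C_sub (sF k) => z [].
- by apply: class_C_sub (sG k) => z [].
Qed.

Lemma smooth_near_mul u (a b : V -> R) :
  smooth_near u a -> smooth_near u b -> smooth_near u (fun z => a z * b z).
Proof.
move=> [U [oU Uu sF]] [U' [oU' Uu' sG]]; have oI := openI oU oU'.
exists (U `&` U'); split=> // k; apply: class_C_mul => //.
- by apply: class_C_sub (sF k) => z [].
- by apply: class_C_sub (sG k) => z [].
Qed.

Lemma smooth_near_scale u W (a : V -> R) (w : W) :
  smooth_near u a -> smooth_near u (fun z => a z *: w).
Proof. by move=> [U [oU Uu sa]]; exists U; split=> // k; exact: class_C_scale. Qed.

Lemma smooth_near_inv u (a : V -> R) :
  a u != 0 -> smooth_near u a -> smooth_near u (fun z => (a z)^-1).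
Proof.
move=> a0 sa; have [U [oU Uu sU]] := sa.
have ca : {for u, continuous a}.
  exact/differentiable_continuous/smooth_near_differentiable.
pose U' := U `&` interior [set z | a z != 0].
have oU' : open U' by apply: openI => //; exact: open_interior.
exists U'; split=> //.
  split=> //; exact: (ca _ (open_nbhs_nbhs (conj (@open_neq R 0) a0))).
move=> k; apply: class_C_inv => //; first by move=> z [_ /interior_subset].
by apply: class_C_sub (sU k) => z [].
Qed.

Lemma smooth_near_sum u W I (r : seq I) (P : pred I) (F : I -> V -> W) :
  (forall i, smooth_near u (F i)) ->
  smooth_near u (fun z => \sum_(i <- r | P i) F i z).
Proof.
move=> sF; elim: r => [|i r IH].
  by apply: smooth_near_eq (smooth_near_cst u (0 : W)) => z; rewrite big_nil.
case: (boolP (P i)) => Pi; last first.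
  by apply: smooth_near_eq IH => z; rewrite big_cons (negPf Pi).
by apply: smooth_near_eq (smooth_near_add (sF i) IH) => z; rewrite big_cons Pi.
Qed.

Lemma smooth_near_prod u I (r : seq I) (F : I -> V -> R) :
  (forall i, smooth_near u (F i)) ->
  smooth_near u (fun z => \prod_(i <- r) F i z).
Proof.
move=> sF; elim: r => [|i r IH].
  by apply: smooth_near_eq (smooth_near_cst u (1 : R)) => z; rewrite big_nil.
by apply: smooth_near_eq (smooth_near_mul (sF i) IH) => z; rewrite big_cons.
Qed.

Lemma smooth_near_det u m (M : V -> 'M[R]_m) :
  (forall i j, smooth_near u (fun z => M z i j)) ->
  smooth_near u (fun z => \det (M z)).
Proof.
move=> sM; apply: smooth_near_sum => s.
apply: smooth_near_mul; first exact: smooth_near_cst.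
by apply: smooth_near_prod => i; exact: sM.
Qed.

(** By Cramer's rule the entries of the inverse are cofactors divided by the
    determinant, and both are polynomials in the entries. *)
Lemma smooth_near_invmx u m (M : V -> 'M[R]_m) i j :
  (forall i j, smooth_near u (fun z => M z i j)) ->
  (\near u, M u \in unitmx) ->
  smooth_near u (fun z => invmx (M z) i j).
Proof.
move=> sM Mu.
have s : smooth_near u (fun z => (\det (M z))^-1 * \adj (M z) i j).
  apply: smooth_near_mul.
    apply: smooth_near_inv; last exact: smooth_near_det.
    by have := nbhs_singleton Mu; rewrite unitmxE unitfE.
  apply: (@smooth_near_eq _ _ (fun z => cofactor (M z) j i)).
    by move=> z; rewrite mxE.
  apply: smooth_near_mul; first exact: smooth_near_cst.
  apply: smooth_near_det => k l.
  by apply: smooth_near_eq (sM (lift j k) (lift i l)) => z; rewrite !mxE.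
apply: smooth_near_ext s; apply: filterS Mu => z Mz.
by rewrite /invmx Mz !mxE.
Qed.

End Smooth.

(** * Positive definite bilinear forms and alternating forms *)

Section LinearAlgebra.
Variables (R : realType) (n : nat).

Lemma linear_form_coord (L : 'rV[R]_n -> R) (w : 'rV[R]_n) :
  (forall a w w', L (a *: w + w') = a * L w + L w') ->
  L w = \sum_k w 0 k * L (delta_mx 0 k).
Proof.
move=> Llin; have L0 : L 0 = 0.
  apply: (addrI (L 0)); have := Llin 1 0 0.
  by rewrite scaler0 addr0 mul1r addr0 => <-.
rewrite [in LHS](row_sum_delta w).
elim/big_rec2: _ => [//|k _ z _ <-]; exact: Llin.
Qed.

Variable b : 'rV[R]_n -> 'rV[R]_n -> R.

Definition gram : 'M[R]_n := \matrix_(i, j) b (delta_mx 0 i) (delta_mx 0 j).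

Hypothesis b_lin : forall a v v' w, b (a *: v + v') w = a * b v w + b v' w.

Lemma mul_gramE w j : (w *m gram) 0 j = b w (delta_mx 0 j).
Proof.
rewrite (linear_form_coord w (fun a v v' => b_lin a v v' (delta_mx 0 j))) mxE.
by apply: eq_bigr => k _; rewrite mxE.
Qed.

Hypothesis b_sym : forall v w, b v w = b w v.
Hypothesis b_pos : forall v, v != 0 -> 0 < b v v.

Lemma b_coord w v : b w v = \sum_j v 0 j * (w *m gram) 0 j.
Proof.
rewrite (linear_form_coord (L := b w)) => [|a v1 v2].
  by apply: eq_bigr => k _; rewrite mul_gramE.
by rewrite !(b_sym w) b_lin.
Qed.

(** A vector killed by the Gram matrix is orthogonal to itself. *)
Lemma gram_unit : gram \in unitmx.
Proof.
rewrite unitmxE unitfE; apply/negP => /det0P[v v0 vG].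
have := b_pos v0; rewrite b_coord vG big1 ?ltxx // => j _.
by rewrite mxE mulr0.
Qed.

Lemma riesz_exists (L : 'rV[R]_n -> R) :
  (forall a w w', L (a *: w + w') = a * L w + L w') ->
  exists w, forall v, b w v = L v.
Proof.
move=> Llin; exists ((\row_j L (delta_mx 0 j)) *m invmx gram) => v.
rewrite b_coord (mulmxKV gram_unit) (linear_form_coord v Llin).
by apply: eq_bigr => j _; rewrite mxE.
Qed.

(** The explicit coordinates make the dual vector depend on [L] and [b] through
    matrix operations only, so that it inherits their smoothness. *)
Lemma riesz_coord (L : 'rV[R]_n -> R) w : (forall v, b w v = L v) ->
  w = (\row_j L (delta_mx 0 j)) *m invmx gram.
Proof.
move=> wL; rewrite -[LHS](mulmxK gram_unit); congr (_ *m _).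
by apply/rowP => j; rewrite mul_gramE mxE wL.
Qed.

End LinearAlgebra.

Section Alternating.
Variables (R : realType) (V : lmodType R).

(** Contraction with [w] precomposes a form with this map on argument tuples. *)
Definition slot0 (p : nat) (w : V) (v : 'I_p -> V) : 'I_p.+1 -> V :=
  fun i => oapp v w (unlift ord0 i).

Lemma slot0_dfwith p w w' (v : 'I_p -> V) :
  dfwith (slot0 w v) ord0 w' = slot0 w' v.
Proof.
apply/funext => k; case: dfwithP => [|j jk]; first by rewrite /slot0 unlift_none.
by rewrite /slot0; case: unliftP jk => [l ->|-> /eqP].
Qed.

Variables (p : nat) (A : ('I_p.+1 -> V) -> R).
Hypothesis A_lin : forall v i a w w',
  A (dfwith v i (a *: w + w')) = a * A (dfwith v i w) + A (dfwith v i w').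
Hypothesis A_alt : forall (v : 'I_p.+1 -> V) i j, i != j -> v i = v j -> A v = 0.

Lemma slot0_linear (v : 'I_p -> V) a w w' :
  A (slot0 (a *: w + w') v) = a * A (slot0 w v) + A (slot0 w' v).
Proof. by have := A_lin (slot0 0 v) ord0 a w w'; rewrite !slot0_dfwith. Qed.

(** Polarization: put [v i + v j] in both slots and expand. *)
Lemma alternating_tperm (v : 'I_p.+1 -> V) i j :
  i != j -> A (v \o tperm i j) = - A v.
Proof.
move=> ij.
(* B a b is A v with the arguments i and j replaced by a and b. *)
pose B a b := A (dfwith (dfwith v i a) j b).
have dC a b : dfwith (dfwith v i a) j b = dfwith (dfwith v j b) i a.
  apply/funext => k; case: (eqVneq k i) => [->|ki].
    by rewrite dfwithin dfwithout 1?eq_sym// dfwithin.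
  rewrite [RHS]dfwithout 1?eq_sym//; case: (eqVneq k j) => [->|kj].
    by rewrite !dfwithin.
  by rewrite !dfwithout 1?eq_sym.
have BDr a b b' : B a (b + b') = B a b + B a b'.
  by have := A_lin (dfwith v i a) j 1 b b'; rewrite scale1r mul1r.
have BDl a a' b : B (a + a') b = B a b + B a' b.
  by have := A_lin (dfwith v j b) i 1 a a'; rewrite scale1r mul1r /B !dC.
have B0 a : B a a = 0.
  by apply: (A_alt ij); rewrite dfwithin dfwithout 1?eq_sym// dfwithin.
have Bv : B (v i) (v j) = A v.
  congr A; apply/funext => k; case: dfwithP => // l jl.
  by case: dfwithP.
have Bt : B (v j) (v i) = A (v \o tperm i j).
  congr A; apply/funext => k /=; case: tpermP => [->|->|ki kj].
  - by rewrite dfwithout 1?eq_sym// dfwithin.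
  - by rewrite dfwithin.
  - by rewrite !dfwithout // eq_sym; apply/eqP.
have := B0 (v i + v j); rewrite BDl !BDr !B0 add0r addr0 Bv Bt => /eqP.
by rewrite addrC addr_eq0 => /eqP.
Qed.

(** The cycle that brings the [i]-th argument to the front is a product of [i]
    transpositions of neighbours. *)
Lemma alternating_rotate (v : 'I_p.+1 -> V) (i : 'I_p.+1) :
  A (slot0 (v i) (v \o lift i)) = (-1) ^+ i * A v.
Proof.
move: {2}(nat_of_ord i) (erefl (nat_of_ord i)) => m.
elim: m i v => [|m IH] i v im.
  have -> : i = ord0 by exact: val_inj.
  rewrite mul1r; congr A; apply/funext => k.
  by rewrite /slot0; case: unliftP => [l|] ->.
have mp : (m < p.+1)%N by rewrite ltnW // -im.
(* The neighbour on the left: swapping slots i and j reduces i to i - 1. *)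
pose j := Ordinal mp; have ij : i != j by rewrite -val_eqE /= im gtn_eqF.
have := IH j (v \o tperm i j) erefl.
rewrite alternating_tperm // im /= tpermR exprS mulN1r mulNr mulrN => <-.
congr (A (slot0 _ _)); apply/funext => k /=; congr v; apply: val_inj.
case: tpermP => [/(congr1 val)|/(congr1 val)|/eqP + _];
  rewrite -?val_eqE /= /bump im; case: leqP; case: leqP; lia.
Qed.

(** The sign matches the one with which the [i]-th derivative enters the
    exterior derivative, so that the two cancel. *)
Lemma alternating_slot0 (v : 'I_p.+1 -> V) (i : 'I_p.+1) w :
  A (slot0 w (v \o lift i)) = (-1) ^+ i * A (dfwith v i w).
Proof.
rewrite -alternating_rotate dfwithin; congr (A (slot0 _ _)).
by apply/funext => k /=; rewrite dfwithout // neq_lift.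
Qed.

End Alternating.

(** * Change of charts *)

Section Charts.
Variables (R : realType) (n : nat) (X : smooth_manifold R n).
Implicit Types (x y : X) (c : chart R n X).

Lemma atlas_chart_at x : atlas (chart_at x).
Proof. by rewrite /chart_at; case: cid => c []. Qed.

Lemma chart_dom_at x : chart_dom (chart_at x) x.
Proof. by rewrite /chart_at; case: cid => c []. Qed.

Lemma near_chart_img c y : chart_dom c y -> \forall u \near c y, chart_img c u.
Proof.
move=> cy; apply: open_nbhs_nbhs; split; first exact: chart_img_open.
exact: chart_to_img.
Qed.

Lemma near_chart_inv_dom c c' y : chart_dom c y -> chart_dom c' y ->
  \forall u \near c y, chart_dom c' (chart_inv c u).
Proof.
move=> cy c'y; apply: (chart_inv_cont (chart_to_img cy)).
by rewrite chart_toK //; apply: open_nbhs_nbhs; split=> //; exact: chart_dom_open.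
Qed.

Lemma transition_differentiable c c' y : atlas c -> atlas c' ->
  chart_dom c y -> chart_dom c' y -> differentiable (c' \o chart_inv c) (c y).
Proof.
move=> ac ac' cy c'y; have [dF _] := atlas_compat ac ac' 1%N; apply: dF.
by split; [exact: chart_to_img|rewrite /preimage /= chart_toK].
Qed.

(** The two transition maps are inverse to each other near the image of [y], so
    the chain rule makes their differentials inverse. *)
Lemma transition_diffK c c' y e : atlas c -> atlas c' ->
  chart_dom c y -> chart_dom c' y ->
  'd (c \o chart_inv c') (c' y) ('d (c' \o chart_inv c) (c y) e) = e.
Proof.
move=> ac ac' cy c'y; have c'E : c' y = (c' \o chart_inv c) (c y).
  by rewrite /= chart_toK.
have dc := transition_differentiable ac ac' cy c'y.
have := transition_differentiable ac' ac c'y cy; rewrite c'E => dc'.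
transitivity ('d ((c \o chart_inv c') \o (c' \o chart_inv c)) (c y) e).
  by rewrite [in RHS](diff_comp dc dc').
have near_id : \forall u \near c y, id u =
    ((c \o chart_inv c') \o (c' \o chart_inv c)) u.
  near=> u => /=; rewrite chart_toK; last by near: u; exact: near_chart_inv_dom.
  by rewrite chart_invK //; near: u; exact: near_chart_img.
have [_ ->] := near_eq_diff near_id ex_diff.
by rewrite diff_val.
Unshelve. all: by end_near. Qed.

Lemma chart_frameK c y e : atlas c -> chart_dom c y ->
  chart_diff c (chart_frame c y e) = e.
Proof.
move=> ac cy; apply: transition_diffK => //; first exact: atlas_chart_at.
exact: chart_dom_at.
Qed.

Lemma chart_diffK c y (w : tangent y) : atlas c -> chart_dom c y ->
  chart_frame c y (chart_diff c w) = w.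
Proof.
move=> ac cy; apply: transition_diffK => //; first exact: atlas_chart_at.
exact: chart_dom_at.
Qed.

(** Tangent vectors at [x] are coordinate vectors in [chart_at x], so the frame
    of that very chart is the identity at [x] (at nearby points it need not
    be, since their own chosen charts may differ). *)
Lemma chart_frame_at x e : chart_frame (chart_at x) x e = e.
Proof.
have a := atlas_chart_at x; have d := chart_dom_at x.
have near_id : \forall u \near chart_at x x,
    id u = (chart_at x \o chart_inv (chart_at x)) u.
  by near=> u => /=; rewrite chart_invK //; near: u; exact: near_chart_img.
have [_ E] := near_eq_diff near_id ex_diff.
by rewrite /chart_frame E diff_val.
Unshelve. all: by end_near. Qed.

Lemma chart_frame_linear c y a e e' :
  chart_frame c y (a *: e + e') = a *: chart_frame c y e + chart_frame c y e'.
Proof. exact: linearP. Qed.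

Lemma chart_frame_neq0 c y e : atlas c -> chart_dom c y -> e != 0 ->
  chart_frame c y e != 0.
Proof.
move=> ac cy; apply: contra => /eqP e0; rewrite -(chart_frameK e ac cy) e0.
by apply/eqP; exact: linear0.
Qed.

Lemma smooth_coord_field x v : smooth_field_near x (coord_field (v : tangent x)).
Proof.
apply: smooth_near_ext (smooth_near_cst _ v).
near=> u; rewrite /field_rep /coord_field chart_frameK //.
  exact: atlas_chart_at.
apply: chart_inv_dom; near: u; exact/near_chart_img/chart_dom_at.
Unshelve. all: by end_near. Qed.

Lemma derive_coord_field x (v w : tangent x) :
  'D_w (field_rep (chart_at x) (coord_field v)) (chart_at x x) = 0.
Proof.
rewrite -(@derive_cst R 'rV[R]_n 'rV[R]_n v (chart_at x x) w).
apply: near_eq_derive.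
near=> u; rewrite /field_rep /coord_field chart_frameK //.
  exact: atlas_chart_at.
apply: chart_inv_dom; near: u; exact/near_chart_img/chart_dom_at.
Unshelve. all: by end_near. Qed.

Lemma dir_deriv_linear x (f : X -> R) a (v w : tangent x) :
  smooth_fun_near x f ->
  dir_deriv (a *: v + w) f = a * dir_deriv v f + dir_deriv w f.
Proof.
move=> /smooth_near_differentiable df.
by rewrite /dir_deriv !deriveE // linearP.
Qed.

(** Directional derivatives do not depend on the chart used to compute them;
    this lets the defining property of the gradient, stated at each point in
    its own chart, be read in one chart on a whole neighbourhood. *)
Lemma dir_deriv_frame c y (f : X -> R) e : atlas c -> chart_dom c y ->
  smooth_fun_near y f ->
  dir_deriv (chart_frame c y e) f = 'D_e (fun_rep c f) (c y).
Proof.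
move=> ac cy /smooth_near_differentiable df.
set cy' := chart_at y in df *.
have dc : differentiable (cy' \o chart_inv c) (c y).
  apply: transition_differentiable => //; first exact: atlas_chart_at.
  exact: chart_dom_at.
have E : cy' y = (cy' \o chart_inv c) (c y) by rewrite /= chart_toK.
have near_f : \forall u \near c y,
    (fun_rep cy' f \o (cy' \o chart_inv c)) u = fun_rep c f u.
  near=> u; rewrite /fun_rep /= chart_toK //; near: u.
  by apply: near_chart_inv_dom => //; exact: chart_dom_at.
have dfE : differentiable (fun_rep cy' f) ((cy' \o chart_inv c) (c y)).
  by rewrite -E.
rewrite -(near_eq_derive _ near_f) (deriveE _ (differentiable_comp dc dfE)).
by rewrite [in RHS](diff_comp dc dfE) /dir_deriv (deriveE _ df) -/cy' [in LHS]E.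
Unshelve. all: by end_near. Qed.

End Charts.

(** * Smoothness of the gradient *)

Section Gradient.
Variables (R : realType) (n : nat) (X : smooth_manifold R n).
Variables (g : forall x : X, tangent x -> tangent x -> R) (f : X -> R).
Hypothesis (g_metric : riemannian_metric g) (f_smooth : smooth_fun f).

Lemma gradE (x : X) (v : tangent x) : g (grad g f x) v = dir_deriv v f.
Proof.
have [g_lin g_sym g_pos _] := g_metric.
have [w gw] := riesz_exists (g_lin x) (g_sym x) (g_pos x)
  (fun a v w => dir_deriv_linear a v w (f_smooth x)).
have := @xgetI _ (0 : tangent x)
  [set w : tangent x | forall v : tangent x, g w v = dir_deriv v f] w gw.
exact.
Qed.

Lemma gram_metric_unit (c : chart R n X) u : atlas c -> chart_img c u ->
  gram (metric_rep c g u) \in unitmx.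
Proof.
have [g_lin g_sym g_pos _] := g_metric; move=> ac cu.
apply: gram_unit => [a v v' w|v w|v v0]; rewrite /metric_rep.
- by rewrite chart_frame_linear g_lin.
- exact: g_sym.
- by apply: g_pos; apply: chart_frame_neq0 => //; exact: chart_inv_dom.
Qed.

(** In coordinates, the relation [g (grad f) e = df e] is the linear system
    whose matrix is the Gram matrix of [g] in the frame of [c]. *)
Lemma field_rep_grad (c : chart R n X) u : atlas c -> chart_img c u ->
  field_rep c (grad g f) u =
    (\row_j 'D_(delta_mx 0 j) (fun_rep c f) u) *m invmx (gram (metric_rep c g u)).
Proof.
have [g_lin g_sym g_pos _] := g_metric; move=> ac cu.
have cy := chart_inv_dom cu.
apply: (@riesz_coord _ _ (metric_rep c g u) _ _ _ (fun e => 'D_e (fun_rep c f) u)).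
- by move=> a v v' w; rewrite /metric_rep chart_frame_linear g_lin.
- by move=> v w; exact: g_sym.
- by move=> v v0; apply: g_pos; exact: chart_frame_neq0.
move=> v; rewrite /metric_rep /field_rep chart_diffK // gradE.
by rewrite dir_deriv_frame // chart_invK.
Qed.

Lemma smooth_grad (x : X) : smooth_field_near x (grad g f).
Proof.
have [_ _ _ g_smooth] := g_metric.
have ac := atlas_chart_at x; have near_img := near_chart_img (chart_dom_at x).
pose c := chart_at x.
pose a j u := \sum_k 'D_(delta_mx 0 k) (fun_rep c f) u *
  invmx (gram (metric_rep c g u)) k j.
apply: (@smooth_near_ext _ _ _ _ (fun u => \sum_j a j u *: delta_mx 0 j)).
  near=> u; have cu : chart_img c u by near: u.
  rewrite field_rep_grad // [RHS]row_sum_delta; apply: eq_bigr => j _.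
  by congr (_ *: _); rewrite mxE; apply: eq_bigr => k _; rewrite mxE.
apply: smooth_near_sum => j; apply: smooth_near_scale; apply: smooth_near_sum => k.
apply: smooth_near_mul; first exact/smooth_near_derive/f_smooth.
apply: smooth_near_invmx => [i l|].
  apply: smooth_near_eq (g_smooth x (delta_mx 0 i) (delta_mx 0 l)) => u.
  by rewrite mxE.
apply: filterS near_img => u cu; exact: gram_metric_unit.
Unshelve. all: by end_near. Qed.

End Gradient.

(** * Interior products in a chart *)

Section Forms.
Variables (R : realType) (n : nat) (X : smooth_manifold R n).

Lemma slot0_comp (V W : lmodType R) (h : V -> W) p w (v : 'I_p -> V) :
  h \o slot0 w v = slot0 (h w) (h \o v).
Proof. by apply/funext => i; rewrite /slot0 /=; case: unlift. Qed.

Lemma form_rep_at (x : X) p (phi : preform X p) (v : 'I_p -> tangent x) :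
  form_rep (chart_at x) phi (chart_at x x) v = phi x v.
Proof.
rewrite /form_rep chart_toK; last exact: chart_dom_at.
by congr (phi x _); apply/funext => i; exact: chart_frame_at.
Qed.

Lemma field_rep_at (x : X) (W : vector_field X) :
  field_rep (chart_at x) W (chart_at x x) = W x.
Proof.
have ac := atlas_chart_at x; have dx := chart_dom_at x.
rewrite /field_rep chart_toK // -[in LHS](chart_frame_at x (W x)).
exact: chart_frameK.
Qed.

Variables (p : nat) (phi : preform X p.+1).
Hypothesis phi_form : differential_form phi.

Lemma form_rep_slot0 (c : chart R n X) u w (v : 'I_p -> 'rV[R]_n) :
  form_rep c phi u (slot0 w v) =
  \sum_k w 0 k * form_rep c phi u (slot0 (delta_mx 0 k) v).
Proof.
have [phi_lin _ _] := phi_form.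
apply: (linear_form_coord (L := fun w => form_rep c phi u (slot0 w v))).
move=> a w1 w2; rewrite /form_rep.
have E w' : (fun i => chart_frame c (chart_inv c u) (slot0 w' v i)) =
  slot0 (chart_frame c (chart_inv c u) w') (chart_frame c (chart_inv c u) \o v).
  exact: slot0_comp.
by rewrite !E chart_frame_linear slot0_linear //; exact: phi_lin.
Qed.

Lemma form_rep_interior (c : chart R n X) (W : vector_field X) u v :
  atlas c -> chart_img c u ->
  form_rep c (interior_product W phi) u v =
  form_rep c phi u (slot0 (field_rep c W u) v).
Proof.
move=> ac cu; rewrite /form_rep /interior_product.
congr (phi _); apply/funext => i.
rewrite -[W _](chart_diffK _ ac (chart_inv_dom cu)) -/(field_rep c W u).
by rewrite /slot0; case: unlift.
Qed.

(** The Leibniz rule for the contraction of [W] with [phi].  Since [phi] is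
    linear in its first slot, the contraction is a finite sum of products of a
    coordinate of [W] with a coefficient of [phi], and the product rule for
    functions applies to each of them. *)
Lemma derive_interior (x : X) (W : vector_field X) (z : tangent x)
    (v : 'I_p -> tangent x) : smooth_field_near x W ->
  'D_z (fun u => form_rep (chart_at x) (interior_product W phi) u v)
      (chart_at x x) =
  'D_z (fun u => form_rep (chart_at x) phi u (slot0 (W x) v)) (chart_at x x) +
  phi (slot0 ('D_z (field_rep (chart_at x) W) (chart_at x x) : tangent x) v).
Proof.
move=> W_smooth; have [_ _ phi_smooth] := phi_form.
have ac := atlas_chart_at x.
rewrite -form_rep_at -[in X in _ = X + _]field_rep_at.
move: (near_chart_img (chart_dom_at x)) W_smooth (phi_smooth x).
set c := chart_at x; set u0 := c x; move=> near_img W_smooth phi_s.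
have dphi w : derivable (fun u => form_rep c phi u w) u0 z.
  exact/diff_derivable/smooth_near_differentiable.
have dW : derivable (field_rep c W) u0 z.
  exact/diff_derivable/smooth_near_differentiable.
have dWk k : derivable (fun u => field_rep c W u 0 k) u0 z.
  by have /derivable_mxP := dW.
(* F k is the coefficient of phi that multiplies the k-th coordinate of W. *)
pose F k u := form_rep c phi u (slot0 (delta_mx 0 k) v).
transitivity ('D_z (\sum_k ((fun u => field_rep c W u 0 k) * F k)) u0).
  apply: near_eq_derive; apply: filterS near_img => u cu.
  by rewrite form_rep_interior // form_rep_slot0 fct_sumE.
rewrite derive_sum => [|k]; last by apply: derivableM => //; exact: dphi.
transitivity ('D_z (\sum_k (field_rep c W u0 0 k *: F k)) u0 +
    form_rep c phi u0 (slot0 ('D_z (field_rep c W) u0) v)); last first.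
  suff -> : \sum_k (field_rep c W u0 0 k *: F k) =
    (fun u => form_rep c phi u (slot0 (field_rep c W u0) v)) by [].
  by apply/funext => u; rewrite [RHS]form_rep_slot0 fct_sumE.
rewrite derive_sum => [|k]; last by apply: derivableZ; exact: dphi.
rewrite form_rep_slot0 -big_split; apply: eq_bigr => k _.
rewrite deriveM ?deriveZ; [|exact: dphi|exact: dWk|exact: dphi].
by congr (_ + _); rewrite derive_mx // mxE mulrC.
Qed.

End Forms.

(** * The Hessian formula *)

Section Hessian.
Variables (R : realType) (n : nat) (X : smooth_manifold R n).

(** Vanishing torsion exchanges the roles of [W] and of the field with constant
    coordinates; only the derivative of [W] survives in their bracket. *)
Lemma levi_civita_coord_field (g : forall x : X, tangent x -> tangent x -> R)
    (D : forall x : X, tangent x -> vector_field X -> tangent x)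
    (x : X) (v : tangent x) (W : vector_field X) :
  levi_civita g D -> smooth_field_near x W ->
  D x v W = D x (W x) (coord_field v) +
            'D_v (field_rep (chart_at x) W) (chart_at x x).
Proof.
move=> [_ torsion_free _] W_smooth.
have := torsion_free x _ _ (smooth_coord_field v) W_smooth.
rewrite /lie_bracket derive_coord_field subr0 /coord_field chart_frame_at.
by move=> /eqP; rewrite subr_eq addrC => /eqP.
Qed.

Lemma slot0_ord0 (V : lmodType R) p w (v : 'I_p -> V) : slot0 w v ord0 = w.
Proof. by rewrite /slot0 unlift_none. Qed.

Lemma slot0_lift0 (V : lmodType R) p w (v : 'I_p -> V) :
  slot0 w v \o lift ord0 = v.
Proof. by apply/funext => i; rewrite /slot0 /= liftK. Qed.

Lemma slot0_lift (V : lmodType R) p w (v : 'I_p.+1 -> V) i :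
  slot0 w v \o lift (lift ord0 i) = slot0 w (v \o lift i).
Proof.
apply/funext => j; rewrite /slot0 /=; case: (unliftP ord0 j) => [k|] ->.
  have -> : lift (lift ord0 i) (lift ord0 k) = lift ord0 (lift i k).
    by apply: val_inj; rewrite /= /bump; lia.
  by rewrite liftK.
have -> : lift (lift ord0 i) ord0 = ord0 by exact: val_inj.
by rewrite unlift_none.
Qed.

(** Closedness enters here: on the tuple [(w, v)], exactly one term of
    [d phi] differentiates along [w], and the others are the ones produced by
    the exterior derivative of a contraction with [w] frozen. *)
Lemma closed_form_slot0 p (phi : preform X p.+1) x w (v : 'I_p.+1 -> tangent x) :
  closed_form phi ->
  'D_w (fun u => form_rep (chart_at x) phi u v) (chart_at x x) =
  \sum_(i < p.+1) (-1) ^+ i *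
    'D_(v i) (fun u => form_rep (chart_at x) phi u (slot0 w (v \o lift i)))
             (chart_at x x).
Proof.
move=> /(_ x (slot0 w v)); rewrite /ext_deriv big_ord_recl mul1r => /eqP.
rewrite addr_eq0 slot0_ord0 [X in derive X _ w](_ : _ = fun u =>
  form_rep (chart_at x) phi u v) => [/eqP ->|]; last first.
  by apply/funext => u; rewrite -[in RHS](slot0_lift0 w v).
rewrite -sumrN; apply: eq_bigr => i _.
rewrite -(slot0_lift w v i) -[slot0 w v (lift _ _)]/((slot0 w v \o lift ord0) i).
by rewrite slot0_lift0 exprS mulN1r mulNr opprK.
Qed.

End Hessian.

Theorem theorem2p2 (R : realType) (n : nat) (X : smooth_manifold R n)
    (g : forall x : X, tangent x -> tangent x -> R)
    (g_metric : riemannian_metric g)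
    (nabla : forall x : X, tangent x -> vector_field X -> tangent x)
    (nabla_LC : levi_civita g nabla)
    (p : nat) (phi : preform X p.+1)
    (phi_form : differential_form phi) (phi_closed : closed_form phi)
    (f : X -> R) (f_smooth : smooth_fun f) :
  forall (x : X) (v : 'I_p.+1 -> tangent x),
    phi_hessian g nabla phi f v =
      ext_deriv (d_phi g phi f) v - cov_deriv_form nabla phi (grad g f x) v.
Proof.
move=> x v; have [phi_lin phi_alt _] := phi_form.
have W_smooth := smooth_grad g_metric f_smooth x.
set W := grad g f in W_smooth *.
have addP i (a b : tangent x) :
    phi x (dfwith v i (a + b)) = phi x (dfwith v i a) + phi x (dfwith v i b).
  by have := phi_lin x v i 1 a b; rewrite scale1r mul1r.
rewrite /phi_hessian /ext_deriv /cov_deriv_form /d_phi.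
under eq_bigr => i _ do
  rewrite (levi_civita_coord_field _ nabla_LC W_smooth) addP.
under [X in _ = X - _]eq_bigr => i _ do
  rewrite (derive_interior phi_form _ _ W_smooth) mulrDr.
rewrite !big_split /=.
rewrite -(closed_form_slot0 (W x) v phi_closed).
under [X in _ = _ + X - _]eq_bigr => i _ do
  rewrite (alternating_slot0 (phi_lin x) (phi_alt x)) mulrA -exprD addnn
          -mul2n exprM sqrrN !expr1n mul1r.
(* In the chart at x, the coordinate fields turn phi into its local expression. *)
rewrite -[dir_deriv (W x) _]/('D_(W x) ((form_rep (chart_at x) phi)^~ v)
  (chart_at x x)).
by ring.
Qed.
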